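(* Let $W$ be the Witt group of finite bilinear forms. If $(\mathscr{D},b)$ is a bilinear $\mathsf{T}$-form, then its class $[(\mathscr{D},b)]\in W$ satisfies $2[(\mathscr{D},b)]=0$. Conversely, every element $w\in W$ with $2w=0$ is the class of some bilinear $\mathsf{T}$-form.
   Context: A finite bilinear form $(\mathscr{D},b)$ is a finite abelian group $\mathscr{D}$ with a symmetric, bilinear, non-degenerate map $b:\mathscr{D}\times\mathscr{D}\to\mathbb{Q}/\mathbb{Z}$; isomorphism of forms means a group isomorphism $f$ with $b=b'\circ(f\times f)$. It is a bilinear $\mathsf{T}$-form if $(\mathscr{D},b)\cong(\mathscr{D},-b)$. A finite bilinear form is split if there is a direct summand $\mathscr{D}'\subseteq\mathscr{D}$ whose orthogonal complement with respect to $b$ is exactly $\mathscr{D}'$. The Witt group $W$ is the monoid of isomorphism classes of finite bilinear forms under orthogonal direct sum, modulo the relation $b\sim b'$ iff $b\oplus s\cong b'\oplus s'$ for some split forms $s,s'$; it is an abelian group. *)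

(* Defs.v *)
From HB Require Import structures.
From mathcomp Require Import all_boot all_algebra.
Set Implicit Arguments. Unset Strict Implicit. Unset Printing Implicit Defensive.
Import GRing.Theory Num.Theory.
Local Open Scope ring_scope.

(* Q/Z : a map into Q/Z is represented by a rational-valued lift; all
   statements about its values are made modulo Z. *)
Definition eqQZ (x y : rat) : Prop := (x - y) \is a Num.int.

Record fbdata := FBData {
  carrier : finZmodType;
  bf : carrier -> carrier -> rat
}.
Arguments bf : clear implicits.

Definition is_fbform (F : fbdata) : Prop :=
  [/\ forall x x' y, eqQZ (bf F (x + x') y) (bf F x y + bf F x' y),
      forall x y y', eqQZ (bf F x (y + y')) (bf F x y + bf F x y'),
      forall x y, eqQZ (bf F x y) (bf F y x) &
      forall x, (forall y, eqQZ (bf F x y) 0) -> x = 0].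

Definition fb_iso (F G : fbdata) : Prop :=
  exists f : carrier F -> carrier G,
    [/\ {morph f : x y / x + y}, bijective f &
        forall x y, eqQZ (bf F x y) (bf G (f x) (f y))].

Definition fb_neg (F : fbdata) : fbdata :=
  @FBData (carrier F) (fun x y => - bf F x y).

Definition is_Tform (F : fbdata) : Prop := is_fbform F /\ fb_iso F (fb_neg F).

Definition prodFZ (A B : finZmodType) : finZmodType :=
  HB.pack_for finZmodType (A * B)%type
    (GRing.Zmodule.class (A * B)%type) (Finite.class (A * B)%type).

Definition osum (F G : fbdata) : fbdata :=
  @FBData (prodFZ (carrier F) (carrier G))
    (fun x y => bf F (fst x) (fst y) + bf G (snd x) (snd y)).

Definition is_subgroup (D : finZmodType) (S : {set D}) : Prop :=
  0 \in S /\ forall x y, x \in S -> y \in S -> x - y \in S.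

Definition is_direct_summand (D : finZmodType) (S : {set D}) : Prop :=
  is_subgroup S /\
  exists C : {set D}, [/\ is_subgroup C,
    (forall x, x \in S -> x \in C -> x = 0) &
    forall z, exists x y, [/\ x \in S, y \in C & z = x + y]].

Definition is_split (F : fbdata) : Prop :=
  is_fbform F /\
  exists S : {set carrier F}, is_direct_summand S /\
    forall x, x \in S <-> (forall y, y \in S -> eqQZ (bf F x y) 0).

Definition witt_eq (F G : fbdata) : Prop :=
  exists S S' : fbdata, [/\ is_split S, is_split S' & fb_iso (osum F S) (osum G S')].

Definition zero_form : fbdata := @FBData ('I_1 : finZmodType) (fun _ _ => 0).

(* Main.v *)
(* If F is isomorphic to -F then F + F is isomorphic to F + -F, and the diagonal
   is a self-orthogonal direct summand.

   For the converse, every split form is metabolic: it lives on D * C with D and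
   C in perfect pairing p, and is p(d,c') + p(d',c) + B(c,c') for a symmetric
   bilinear B on C (this is [metab p B]).  Shearing shows that
   metab(B + B1) + metab(B1) is isomorphic to metab(B) + metab(B1), so up to a
   split summand B is irrelevant, and metab(B) is isomorphic to its negative.
   Suppose F + F + S is isomorphic to S' with S and S' split.  Then F + R is
   isomorphic to -F + S', where R = F + -F + S is split.  If the isomorphism
   class of S' depended only on its underlying group, R and S' would be stably
   isomorphic, and F + R + X would be a T-form for a suitable split X.  For this,
   the summand C has to be recovered from the group D * C: a Fourier double
   count gives #D[n] = #C[n], hence #C[n]^2 = #(D * C)[n], and a finite abelian
   group is determined by the orders of its n-torsion subgroups. *)
From Stdlib Require Import Setoid Morphisms.
From HB Require Import structures.
From mathcomp Require Import all_boot all_algebra all_fingroup.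
From mathcomp Require Import all_solvable all_field.
From mathcomp Require Import ring.
Require Import Defs.
Set Implicit Arguments. Unset Strict Implicit. Unset Printing Implicit Defensive.
Import GRing.Theory Num.Theory.
Local Open Scope ring_scope.

(** * Congruence modulo Z, additive maps into Q/Z and their characters *)

#[local] Instance eqQZ_equiv : Equivalence eqQZ.
Proof.
split=> [x|x y|x y z]; rewrite /eqQZ.
- by rewrite subrr rpred0.
- by rewrite -opprB rpredN.
- by move=> h1 h2; rewrite -(subrKA y) addrC rpredD // addrC.
Qed.
#[local] Instance eqQZ_add : Proper (eqQZ ==> eqQZ ==> eqQZ) +%R.
Proof. by move=> x x' h y y' k; rewrite /eqQZ opprD addrACA rpredD. Qed.
#[local] Instance eqQZ_opp : Proper (eqQZ ==> eqQZ) -%R.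
Proof. by move=> x x' h; rewrite /eqQZ -opprD rpredN. Qed.

Lemma eqQZ_refl x : eqQZ x x. Proof. reflexivity. Qed.
#[local] Hint Resolve eqQZ_refl : core.
Lemma eqQZ_eq x y : x = y -> eqQZ x y. Proof. by move->. Qed.

Lemma eqQZ0 x : eqQZ x 0 <-> x \is a Num.int.
Proof. by rewrite /eqQZ subr0. Qed.

Lemma eqQZ_natmul n x y : eqQZ x y -> eqQZ (x *+ n) (y *+ n).
Proof. by rewrite /eqQZ -mulrnBl; apply: rpredMn. Qed.

Definition addQZ (A : finZmodType) (f : A -> rat) : Prop :=
  forall x y, eqQZ (f (x + y)) (f x + f y).

Section AddQZ.
Variables (A : finZmodType) (f : A -> rat).
Hypothesis fD : addQZ f.

Lemma addQZ0 : eqQZ (f 0) 0.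
Proof.
have := fD 0 0; rewrite addr0 /eqQZ opprD addrA subrr add0r rpredN => h.
by rewrite subr0.
Qed.

Lemma addQZN x : eqQZ (f (- x)) (- f x).
Proof.
have := fD (- x) x; rewrite addNr => h; rewrite addQZ0 in h.
by move: h; rewrite /eqQZ sub0r rpredN opprK.
Qed.

Lemma addQZMn x n : eqQZ (f (x *+ n)) (f x *+ n).
Proof.
elim: n => [|n IHn]; first by rewrite !mulr0n; exact: addQZ0.
by rewrite !mulrS fD IHn.
Qed.

(** By Lagrange, all values lie in the [#|A|]-torsion of Q/Z, which is where a torsion character can
    be applied to them. *)
Lemma addQZ_torsion x : f x *+ #|A| \is a Num.int.
Proof.
apply/eqQZ0; rewrite -addQZMn -FinRing.zmodXgE -cardsT.
by rewrite expg_cardG ?inE //; exact: addQZ0.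
Qed.

End AddQZ.

(* [e] is a faithful character of the [n]-torsion of Q/Z. *)
Definition torsion_char n (e : rat -> algC) : Prop :=
  [/\ forall x y, x *+ n \is a Num.int -> y *+ n \is a Num.int ->
        e (x + y) = e x * e y,
      forall x, x *+ n \is a Num.int -> (e x == 1) = (x \is a Num.int) &
      forall x y, y *+ n \is a Num.int -> eqQZ x y -> e x = e y].

Lemma torsion_char_exists n : (0 < n)%N -> exists e, torsion_char n e.
Proof.
move=> n_gt0; have [w w_prim] := C_prim_root_exists n_gt0.
have wn := prim_expr_order w_prim.
have w0 : w \is a GRing.unit.
  apply/negPn/negP; rewrite unitfE negbK => /eqP w0; move/eqP: wn.
  by rewrite w0 expr0n -[n]prednK //= eq_sym oner_eq0.
(* On the [n]-torsion [x *+ n] is an integer, so the floor merely turns it into an exponent;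
   elsewhere [e] takes junk values. *)
pose e (x : rat) := w ^ Num.floor (x *+ n); exists e.
have eD x y : x *+ n \is a Num.int -> y *+ n \is a Num.int ->
    e (x + y) = e x * e y.
  by move=> xn yn; rewrite /e -expfzDr -?unitfE // mulrnDl floorDzr // Rreal_int.
suff e1 x : x *+ n \is a Num.int -> (e x == 1) = (x \is a Num.int).
  split=> // x y yn xy; have xyZ : x - y \is a Num.int := xy.
  rewrite -(subrK y x) eD //; last exact: rpredMn.
  by move/e1: (rpredMn n xyZ); rewrite xyZ => /eqP->; rewrite mul1r.
move=> xn; rewrite /e.
have n0 : n%:R != 0 :> rat by rewrite pnatr_eq0 -lt0n.
(* The sign of the exponent is dropped, an inverse being 1 exactly when the element is; the order of
   [w] then decides. *)
transitivity (w ^+ `|Num.floor (x *+ n)|%N == 1).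
  by case: (Num.floor _) => // k; rewrite NegzE -exprnN abszN invr_eq1.
rewrite -(prim_order_dvd w_prim) -[LHS]/(n%:Z %| Num.floor (x *+ n))%Z.
apply/dvdzP/intrP => -[q].
  move=> qE; exists q; apply: (mulIf n0).
  by rewrite mulr_natr -(floorK xn) qE intrM.
by move=> xq; exists q; apply: (@intr_inj rat); rewrite floorK // xq intrM mulr_natr.
Qed.

(** Translating the index by [x0] multiplies the sum by [g x0], which differs from 1. *)
Lemma sum_char_eq0 (G : finZmodType) (g : G -> algC) x0 :
  (forall x y, g (x + y) = g x * g y) -> g x0 != 1 -> \sum_x g x = 0.
Proof.
move=> gD gx0; have gx0' : g x0 - 1 != 0 by rewrite subr_eq0.
apply: (mulfI gx0'); rewrite mulr0 mulrBl mul1r mulr_sumr.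
rewrite [X in _ - X](reindex_inj (addrI x0)) /=.
by under eq_bigr do rewrite -gD; rewrite subrr.
Qed.

(** * Perfect pairings: representability and torsion counts *)

Record perfect (D C : finZmodType) (p : D -> C -> rat) : Prop := Perfect {
  perfectDl : forall d d' c, eqQZ (p (d + d') c) (p d c + p d' c);
  perfectDr : forall d c c', eqQZ (p d (c + c')) (p d c + p d c');
  perfect_nondegl : forall d, (forall c, eqQZ (p d c) 0) -> d = 0;
  perfect_nondegr : forall c, (forall d, eqQZ (p d c) 0) -> c = 0 }.

Lemma perfect_sym (D C : finZmodType) (p : D -> C -> rat) :
  perfect p -> perfect (fun c d => p d c).
Proof. by case=> pDl pDr pl pr; split. Qed.

Lemma perfect_inj (D C : finZmodType) (p : D -> C -> rat) d d' : perfect p ->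
  (forall c, eqQZ (p d c) (p d' c)) -> d = d'.
Proof.
move=> pP h; apply/eqP; rewrite -subr_eq0; apply/eqP/(perfect_nondegl pP) => c.
rewrite (perfectDl pP) h (addQZN (fun x y => perfectDl pP x y c)).
by rewrite subrr; reflexivity.
Qed.

(** If no [d] represents [f], every [f - p d] is a nontrivial character of [C], so the double sum of
    [e (f c - p d c)] vanishes. Summed over [d] first, each [c != 0] gives a nontrivial character of
    [D], hence 0, and [c = 0] gives [#|D|]: a contradiction. *)
Lemma perfect_repr (D C : finZmodType) (p : D -> C -> rat) (f : C -> rat) :
  perfect p -> addQZ f -> exists d, forall c, eqQZ (p d c) (f c).
Proof.
move=> pP fD; have C0 : (0 < #|C|)%N by apply/card_gt0P; exists 0.
have pDl c : addQZ (p^~ c) by move=> d d'; exact: perfectDl.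
have pDr d : addQZ (p d) by move=> c c'; exact: perfectDr.
have [e eP] := torsion_char_exists C0; have [eD e1 eE] := eP.
have pT d c : p d c *+ #|C| \is a Num.int by exact: (addQZ_torsion (pDr d)).
have fT c : f c *+ #|C| \is a Num.int by exact: (addQZ_torsion fD).
case: (boolP [exists d, [forall c, (p d c - f c) \is a Num.int]]).
  by move=> /existsP[d /forallP]; exists d.
rewrite negb_exists => /forallP noP.
have e_eq0 : \sum_d \sum_c e (f c - p d c) = 0.
  apply: big1 => d _; have := noP d; rewrite negb_forall => /existsP[c].
  rewrite -rpredN opprB => nc.
  have T c' : (f c' - p d c') *+ #|C| \is a Num.int by rewrite mulrnBl rpredB.
  apply: (sum_char_eq0 (x0 := c)) => [x y|]; last by rewrite e1.
  rewrite -eD //; apply: eE; first by rewrite mulrnDl rpredD.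
  by rewrite fD (pDr d); apply: eqQZ_eq; ring.
have : \sum_c \sum_d e (f c - p d c) = #|D|%:R.
  rewrite (bigD1 0) //= [X in _ + X]big1 ?addr0 => [|c c0].
    rewrite (eq_bigr (fun=> 1)) ?sumr_const // => d _; apply/eqP.
    rewrite e1 ?mulrnBl ?rpredB //; apply/eqQZ0; first exact: (addQZ0 fD).
    exact: (addQZ0 (pDr d)).
  case: (boolP [forall d, p d c \is a Num.int]) => [/forallP pc|].
    by case/eqP: c0; apply: (perfect_nondegr pP) => d; apply/eqQZ0.
  rewrite negb_forall => /existsP[d0 pd0].
  have Tp d : - p d c *+ #|C| \is a Num.int by rewrite mulNrn rpredN.
  under eq_bigr do rewrite eD //.
  rewrite -mulr_sumr (sum_char_eq0 (x0 := d0)) ?mulr0 // => [x y|].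
    rewrite -eD //; apply: eE; first by rewrite mulrnDl rpredD.
    by rewrite (pDl c); apply: eqQZ_eq; ring.
  by rewrite e1 // rpredN.
rewrite exchange_big e_eq0 => /eqP; rewrite eq_sym pnatr_eq0.
by rewrite -leqn0 leqNgt; case/negP; apply/card_gt0P; exists 0.
Qed.

Definition ntorsion (A : finZmodType) n := #|[set x : A | x *+ n == 0]|.

(** For fixed [d] the inner sum runs over the character attached to [d *+ k]: it is [#|C|] if
    [d *+ k = 0], and 0 otherwise by nondegeneracy. *)
Lemma sum_pairing_char (D C : finZmodType) (p : D -> C -> rat) e m k :
  perfect p -> torsion_char m e -> (forall d c, p d c *+ m \is a Num.int) ->
  \sum_d \sum_c e (p d c *+ k) = (ntorsion D k * #|C|)%:R.
Proof.
move=> pP [eD e1 eE] T.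
have Tk d c : p d c *+ k *+ m \is a Num.int by rewrite -mulrnA mulnC mulrnA rpredMn.
have pk d c : eqQZ (p d c *+ k) (p (d *+ k) c).
  by symmetry; exact: (addQZMn (fun d d' => perfectDl pP d d' c)).
rewrite (bigID (fun d => d *+ k == 0)) /= [X in _ + X]big1 ?addr0 => [|d dk0].
  rewrite (eq_bigr (fun=> #|C|%:R)) => [|d /eqP dk0].
    by rewrite sumr_const natrM mulr_natl /ntorsion cardsE.
  rewrite (eq_bigr (fun=> 1)) ?sumr_const // => c _; apply/eqP.
  rewrite e1 //; apply/eqQZ0.
  by rewrite pk dk0 (addQZ0 (fun d d' => perfectDl pP d d' c)).
case: (boolP [forall c, p (d *+ k) c \is a Num.int]) => [/forallP pc|].
  by case/eqP: dk0; apply: (perfect_nondegl pP) => c; apply/eqQZ0.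
rewrite negb_forall => /existsP[c0 pc0].
apply: (sum_char_eq0 (x0 := c0)) => [x y|].
  rewrite -eD //; apply: eE; first by rewrite mulrnDl rpredD.
  by rewrite -mulrnDl; apply: eqQZ_natmul; exact: perfectDr.
rewrite e1 //; apply: contra pc0 => h; apply/eqQZ0.
by rewrite -pk; apply/eqQZ0.
Qed.

Lemma ntorsion1 (A : finZmodType) : ntorsion A 1 = 1%N.
Proof.
rewrite -[RHS](cards1 (0 : A)); apply: eq_card => x.
by rewrite !inE.
Qed.

(** Both orders of summation give [#D[k] * #|C| = #C[k] * #|D|]; the case [k = 1] gives
    [#|C| = #|D|], which cancels. *)
Lemma perfect_ntorsion (D C : finZmodType) (p : D -> C -> rat) k :
  perfect p -> ntorsion D k = ntorsion C k.
Proof.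
move=> pP; have C0 : (0 < #|C|)%N by apply/card_gt0P; exists 0.
have [e eP] := torsion_char_exists C0.
have T d c : p d c *+ #|C| \is a Num.int by exact: (addQZ_torsion (perfectDr pP d)).
have E j : (ntorsion D j * #|C| = ntorsion C j * #|D|)%N.
  apply/eqP; rewrite -(eqr_nat algC) -(sum_pairing_char j pP eP T).
  by rewrite exchange_big /= (sum_pairing_char j (perfect_sym pP) eP).
have := E k; have := E 1%N; rewrite !ntorsion1 !mul1n => <- /eqP.
by rewrite eqn_pmul2r // => /eqP.
Qed.

(** * Finite abelian groups are determined by their torsion counts *)

Lemma card_Ldiv_cycle (gT : finGroupType) (x : gT) n :
  #|'Ldiv_n(<[x]>)%g| = gcdn n #[x]%g.
Proof.
set o := #[x]%g; set g := gcdn n o.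
have g0 : (0 < g)%N by rewrite gcdn_gt0 order_gt0 orbT.
have go : (g %| o)%N by exact: dvdn_gcdr.
suff -> : 'Ldiv_n(<[x]>)%g = <[x ^+ (o %/ g)]>%g.
  by rewrite -orderE orderXdiv ?dvdn_div // divnA // mulKn // order_gt0.
apply/setP=> y; apply/LdivP/idP=> [[/cycleP[k ->] xkn]|].
  have okn : (o %| k * n)%N by rewrite order_dvdn expgM xkn.
  have : (o %| k * g)%N by rewrite /g muln_gcdr dvdn_gcd okn dvdn_mull.
  by rewrite -dvdn_divLR // => /dvdnP[q ->]; rewrite mulnC expgM mem_cycle.
case/cycleP=> k ->; rewrite -!expgM mem_cycle; split=> //; apply/eqP.
rewrite -order_dvdn mulnAC -[X in (X %| _)%N](divnK go).
by rewrite dvdn_mulr // dvdn_mul // dvdn_gcdl.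
Qed.

(** The [n]-torsion of [G] is the product of those of [A] and [B], which meet trivially. *)
Lemma card_Ldiv_dprod (gT : finGroupType) (A B G : {group gT}) n :
  abelian G -> (A \x B)%g = G ->
  #|'Ldiv_n(G)%g| = (#|'Ldiv_n(A)%g| * #|'Ldiv_n(B)%g|)%N.
Proof.
move=> cG defG; have [_ ABG cAB tiAB] := dprodP defG.
have sAG : A \subset G by rewrite -ABG mulG_subl.
have sBG : B \subset G by rewrite -ABG mulG_subr.
have cA := abelianS sAG cG; have cB := abelianS sBG cG.
rewrite -(TI_cardMg (G := Group (group_Ldiv n cA)) (H := Group (group_Ldiv n cB))).
  apply: eq_card => z; apply/idP/idP=> /=.
    case/LdivP; rewrite -{1}ABG => /mulsgP[a b Aa Bb ->].
    have cab : commute a b by apply/commute_sym/(centsP cAB).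
    rewrite expgMn // => /eqP; rewrite mulg_eq1 => /eqP ab.
    have an1 : (a ^+ n = 1)%g.
      by apply/set1gP; rewrite -tiAB inE groupX //= ab groupV groupX.
    have bn1 : (b ^+ n = 1)%g by apply/eqP; rewrite -invg_eq1 -ab an1.
    by apply: mem_mulg; apply/LdivP.
  case/mulsgP=> a b /LdivP[Aa an] /LdivP[Bb bn] ->; apply/LdivP; split.
    by rewrite -ABG mem_mulg.
  by rewrite expgMn ?an ?bn ?mulg1 //; exact/commute_sym/(centsP cAB).
apply/eqP; rewrite eqEsubset sub1G andbT -tiAB.
by rewrite setISS ?subsetIl.
Qed.

Lemma card_Ldiv_bigdprod (gT : finGroupType) (b : seq gT) (G : {group gT}) n :
  abelian G -> (\big[dprod/1]_(x <- b) <[x]>)%g = G ->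
  #|'Ldiv_n(G)%g| = (\prod_(m <- map (fun x => #[x]%g) b) gcdn n m)%N.
Proof.
elim: b G => [|x b IHb] G cG /=; rewrite ?big_nil ?big_cons => defG.
  rewrite -defG; apply/eqP; rewrite -(cards1 (1%g : gT)); apply/eqP/eq_card => y.
  rewrite !inE; case: eqP => // ->.
  by rewrite expg1n eqxx.
have [[_ H _ defH] _ _ _] := dprodP defG; rewrite defH in defG.
have sHG : H \subset G by case/dprodP: defG => _ <- _ _; rewrite mulG_subr.
rewrite (card_Ldiv_dprod n cG defG) card_Ldiv_cycle (IHb H) //.
exact: abelianS cG.
Qed.

(** Each [gcdn a m] is at most [m], so equal products of positive terms force [gcdn a b = b] at the
    head. *)
Lemma prod_gcdn_dvd a b t : all (fun m => 0 < m)%N (b :: t) ->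
  (\prod_(m <- b :: t) gcdn a m = \prod_(m <- b :: t) m)%N -> (b %| a)%N.
Proof.
move=> /andP[b0 t0]; rewrite !big_cons => e; apply/gcdn_idPr/eqP.
have le_b : (gcdn a b <= b)%N by rewrite dvdn_leq ?dvdn_gcdr.
rewrite eqn_leq le_b leqNgt; apply/negP => lt_b; move/eqP: e; apply/negP.
rewrite neq_ltn; apply/orP; left.
have le_t : (\prod_(m <- t) gcdn a m <= \prod_(m <- t) m)%N.
  rewrite big_seq [X in (_ <= X)%N]big_seq; apply: leq_prod => m /(allP t0) m0.
  by rewrite dvdn_leq ?dvdn_gcdr.
apply: (leq_ltn_trans (leq_mul (leqnn _) le_t)); rewrite ltn_pmul2r //.
by rewrite big_seq prodn_cond_gt0 // => m /(allP t0).
Qed.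

(** The value at [n = 0] is the full product of the list. The head of a divisibility chain is a
    multiple of every entry, so it also yields the full product; hence each head divides the other.
    Equal heads cancel and induction applies; entries above 1 rule out different lengths. *)
Lemma prod_gcdn_inj s t :
  sorted [rel m n | n %| m]%N s -> sorted [rel m n | n %| m]%N t ->
  all [pred m | 1 < m]%N s -> all [pred m | 1 < m]%N t ->
  (forall n, \prod_(m <- s) gcdn n m = \prod_(m <- t) gcdn n m)%N -> s = t.
Proof.
have prod0 u : (\prod_(m <- u) gcdn 0 m = \prod_(m <- u) m)%N.
  by apply: eq_bigr => m _; rewrite gcd0n.
have pos u : all [pred m | 1 < m]%N u -> all (fun m => 0 < m)%N u.
  by apply: sub_all => m /ltnW.
have nil_case m u : all [pred m | 1 < m]%N (m :: u) ->
    (\prod_(m <- m :: u) gcdn 0 m <> 1)%N.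
  move=> /= /andP[m1 _] /eqP; rewrite big_cons gcd0n muln_eq1.
  by case/andP => /eqP m_1; rewrite m_1 in m1.
have path_dvd a u : path [rel m n | n %| m]%N a u ->
    (\prod_(m <- a :: u) gcdn a m = \prod_(m <- a :: u) m)%N.
  have tr : transitive [rel m n | n %| m]%N.
    by move=> x y z /= xy zx; exact: dvdn_trans zx xy.
  move/(order_path_min tr)/allP => au; apply: eq_big_seq => m.
  by rewrite inE => /predU1P[->|/au/gcdn_idPr//]; rewrite gcdnn.
elim: s t => [|a s IHs] [|b t] // s_s s_t s1 t1 e.
- by have := e 0%N; rewrite big_nil => /esym/(nil_case _ _ t1).
- by have := e 0%N; rewrite big_nil => /(nil_case _ _ s1).
have e0 := e 0%N; rewrite !prod0 in e0.
have ab : a = b.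
  apply/eqP; rewrite eqn_dvd; apply/andP; split.
    by apply: (prod_gcdn_dvd (pos _ s1)); rewrite e path_dvd.
  by apply: (prod_gcdn_dvd (pos _ t1)); rewrite -e path_dvd.
move: s1 t1 => /andP[a1 s1] /andP[_ t1]; rewrite -ab; congr cons.
apply: IHs => //; [exact: path_sorted s_s|exact: path_sorted s_t|] => n.
have := e n; rewrite -ab !big_cons => /eqP; rewrite eqn_pmul2l; first by move/eqP.
by rewrite gcdn_gt0 (ltnW a1) orbT.
Qed.

(** The torsion counts are the gcd products of the invariant factors, and these form a divisibility
    chain. *)
Lemma abelian_isog_Ldiv (gT rT : finGroupType) (G : {group gT}) (H : {group rT}) :
  abelian G -> abelian H ->
  (forall n, #|'Ldiv_n(G)%g| = #|'Ldiv_n(H)%g|) -> (G \isog H)%g.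
Proof.
move=> cG cH eGH; rewrite eq_abelian_type_isog //; apply/eqP.
apply: prod_gcdn_inj; rewrite ?abelian_type_dvdn_sorted ?abelian_type_gt1 // => n.
have [b defG <-] := abelian_structure cG.
have [c defH <-] := abelian_structure cH.
by rewrite -(card_Ldiv_bigdprod n cG defG) -(card_Ldiv_bigdprod n cH defH).
Qed.

Lemma ntorsion_iso (A B : finZmodType) :
  (forall n, ntorsion A n = ntorsion B n) ->
  exists f : A -> B, {morph f : x y / x + y} /\ bijective f.
Proof.
move=> eAB.
have LT (C : finZmodType) n : #|'Ldiv_n([set: C])%g| = ntorsion C n.
  by rewrite setTI.
have /isogP[f injf fT] : ([set: A] \isog [set: B])%g.
  apply: abelian_isog_Ldiv; rewrite ?FinRing.zmod_abelian // => n.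
  by rewrite !LT.
exists f; split=> [x y|].
  by rewrite -FinRing.zmodMgE morphM ?inE.
apply: inj_card_bij; first by move=> x y; apply: (injmP injf); rewrite inE.
by rewrite -!cardsT -fT card_injm.
Qed.

(** * Subgroups as finite Z-modules *)

(** The closure proof [HS] is a parameter of the type, so that the group operations can be attached
    to it canonically. *)
Record subgroup_of (A : finZmodType) (S : {set A}) (HS : is_subgroup S) :=
  SubgroupOf { sg_val : A; sg_valP : sg_val \in S }.

Section SubgroupOf.
Variables (A : finZmodType) (S : {set A}) (HS : is_subgroup S).
Local Notation B := (subgroup_of HS).

HB.instance Definition _ := [isSub for @sg_val A S HS].
HB.instance Definition _ := [Finite of B by <:].

Lemma sg_mem0 : 0 \in S. Proof. exact: HS.1. Qed.
Lemma sg_memN x : x \in S -> - x \in S.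
Proof. by move=> xS; rewrite -sub0r HS.2 // sg_mem0. Qed.
Lemma sg_memD x y : x \in S -> y \in S -> x + y \in S.
Proof. by move=> xS yS; rewrite -[y]opprK HS.2 // sg_memN. Qed.

Definition sg_zero : B := SubgroupOf HS sg_mem0.
Definition sg_opp (x : B) : B := SubgroupOf HS (sg_memN (sg_valP x)).
Definition sg_add (x y : B) : B := SubgroupOf HS (sg_memD (sg_valP x) (sg_valP y)).

Fact sg_addA : associative sg_add.
Proof. by move=> x y z; apply: val_inj; rewrite /= addrA. Qed.
Fact sg_addC : commutative sg_add.
Proof. by move=> x y; apply: val_inj; rewrite /= addrC. Qed.
Fact sg_add0 : left_id sg_zero sg_add.
Proof. by move=> x; apply: val_inj; rewrite /= add0r. Qed.
Fact sg_addN : left_inverse sg_zero sg_opp sg_add.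
Proof. by move=> x; apply: val_inj; rewrite /= addNr. Qed.
HB.instance Definition _ := GRing.isZmodule.Build B sg_addA sg_addC sg_add0 sg_addN.

End SubgroupOf.

(** * Isomorphisms and orthogonal sums of forms *)

Lemma fb_iso_can (F G : fbdata) (f : carrier F -> carrier G) g :
  cancel f g -> cancel g f -> {morph f : x y / x + y} ->
  (forall x y, eqQZ (bf F x y) (bf G (f x) (f y))) -> fb_iso F G.
Proof. by move=> fg gf fD fb; exists f; split=> //; exists g. Qed.

#[local] Instance fb_iso_equiv : Equivalence fb_iso.
Proof.
split=> [F|F G [f [fD [g fg gf] fb]]|F G H [f [fD fB fb]] [g [gD gB gb]]].
- by apply: (@fb_iso_can F F id id).
- apply: (fb_iso_can gf fg) => [x y|x y]; last by rewrite fb !gf.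
  by apply: (can_inj fg); rewrite fD !gf.
- exists (g \o f); split=> [x y||x y]; first by rewrite /= fD gD.
    exact: bij_comp.
  by rewrite fb gb.
Qed.

#[local] Instance osum_iso : Proper (fb_iso ==> fb_iso ==> fb_iso) osum.
Proof.
move=> F F' [f [fD [f' ff' f'f] fb]] G G' [g [gD [g' gg' g'g] gb]].
apply: (@fb_iso_can (osum F G) (osum F' G') (fun x => (f x.1, g x.2))
          (fun x => (f' x.1, g' x.2))) => [[x y]|[x y]|[x y] [x' y']|[x y] [x' y']] /=.
- by rewrite ff' gg'.
- by rewrite f'f g'g.
- by rewrite fD gD.
- by rewrite fb gb.
Qed.

Lemma osumC F G : fb_iso (osum F G) (osum G F).
Proof.
apply: (@fb_iso_can (osum F G) (osum G F) (fun x => (x.2, x.1))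
          (fun x => (x.2, x.1))) => [[x y]|[x y]|[x y] [x' y']|[x y] [x' y']] //=.
by rewrite addrC.
Qed.

Lemma osumA F G H : fb_iso (osum F (osum G H)) (osum (osum F G) H).
Proof.
apply: (@fb_iso_can (osum F (osum G H)) (osum (osum F G) H)
          (fun x => ((x.1, x.2.1), x.2.2))
          (fun x => (x.1.1, (x.1.2, x.2)))).
- by case=> x [].
- by case=> [[]].
- by case=> x [y z] [x' [y' z']].
- by case=> x [y z] [x' [y' z']] /=; rewrite addrA.
Qed.

Lemma osum0 F : fb_iso (osum F zero_form) F.
Proof.
apply: (@fb_iso_can (osum F zero_form) F (fun x => x.1) (fun x => (x, 0))) => //.
- by case=> x y /=; congr pair; rewrite [y]ord1.
- by case=> x y [x' y'] /=; rewrite addr0.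
Qed.

Lemma osum_neg F G : fb_iso (fb_neg (osum F G)) (osum (fb_neg F) (fb_neg G)).
Proof.
apply: (@fb_iso_can (fb_neg (osum F G)) (osum (fb_neg F) (fb_neg G)) id id) => //.
by move=> x y /=; rewrite opprD.
Qed.

(** * Metabolic forms *)

Record symbil (C : finZmodType) (B : C -> C -> rat) : Prop := Symbil {
  symbilDl : forall c c' x, eqQZ (B (c + c') x) (B c x + B c' x);
  symbilC : forall c c', eqQZ (B c c') (B c' c) }.

Lemma symbilDr (C : finZmodType) (B : C -> C -> rat) x c c' :
  symbil B -> eqQZ (B x (c + c')) (B x c + B x c').
Proof. by move=> BP; rewrite !(symbilC BP x) (symbilDl BP). Qed.

Definition metab (D C : finZmodType) (p : D -> C -> rat) (B : C -> C -> rat) :=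
  @FBData (prodFZ D C) (fun x y => p x.1 y.2 + p y.1 x.2 + B x.2 y.2).

Lemma fbform_perfect F : is_fbform F -> perfect (bf F).
Proof.
case=> Dl Dr sym nd; split=> // c h; apply: nd => y.
by rewrite sym.
Qed.

Lemma fbform_symbil F : is_fbform F -> symbil (bf F).
Proof. by case. Qed.

Section Metab.
Variables (D C : finZmodType) (p : D -> C -> rat).
Hypothesis pP : perfect p.
Implicit Types B : C -> C -> rat.

Lemma metab_fbform B : symbil B -> is_fbform (metab p B).
Proof.
move=> BP; split=> [[d c] [d' c'] [u v]|[u v] [d c] [d' c']|[d c] [d' c']|[d c] h] /=.
- by rewrite (perfectDl pP) (perfectDr pP) (symbilDl BP); apply: eqQZ_eq; ring.
- by rewrite (perfectDl pP) (perfectDr pP) (symbilDr _ _ _ BP); apply: eqQZ_eq; ring.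
- by rewrite (symbilC BP) [p d c' + _]addrC.
have c0 : c = 0.
  apply: (perfect_nondegr pP) => d'; have := h (d', 0); rewrite /=.
  rewrite (addQZ0 (fun x y => perfectDr pP d x y)).
  by rewrite (addQZ0 (fun x y => symbilDr c x y BP)) add0r addr0.
have d0 : d = 0.
  apply: (perfect_nondegl pP) => c'; have := h (0, c'); rewrite /= c0.
  rewrite (addQZ0 (fun x y => perfectDr pP 0 x y)).
  by rewrite (addQZ0 (fun x y => symbilDl BP x y c')) !addr0.
by rewrite c0 d0.
Qed.

Lemma metab_split B : symbil B -> is_split (metab p B).
Proof.
move=> BP; split; first exact: metab_fbform.
have B0 : eqQZ (B 0 0) 0 by exact: (addQZ0 (fun x y => symbilDl BP x y 0)).
have p0 d : eqQZ (p d 0) 0 by exact: (addQZ0 (fun x y => perfectDr pP d x y)).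
(* The self-orthogonal summand is [D * 0], with complement [0 * C]. *)
exists [set x : carrier (metab p B) | x.2 == 0]; split; first split.
- by split=> [|x y]; rewrite !inE // => /eqP x0 /eqP y0; rewrite /= x0 y0 subrr.
- exists [set x : carrier (metab p B) | x.1 == 0]; split.
  + by split=> [|x y]; rewrite !inE // => /eqP x0 /eqP y0; rewrite /= x0 y0 subrr.
  + by case=> d c; rewrite !inE /= => /eqP-> /eqP->.
  + case=> d c; exists (d, 0), (0, c); rewrite !inE /=; split=> //.
    by congr pair; rewrite ?addr0 ?add0r.
- case=> d c; rewrite inE /=; split=> [/eqP-> [d' c']|h].
    by rewrite inE /= => /eqP->; rewrite !p0 B0 !addr0.
  apply/eqP/(perfect_nondegr pP) => d'; have := h (d', 0); rewrite inE /=.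
  move/(_ (eqxx _)); rewrite p0 (addQZ0 (fun x y => symbilDr c x y BP)).
  by rewrite add0r addr0.
Qed.

(** The map [s] is [B] read as a homomorphism from [C] to its dual, identified with [D] by [p];
    uniqueness of representatives makes it additive. *)
Lemma symbil_repr B : symbil B ->
  exists s : C -> D, {morph s : x y / x + y} /\
    forall c c', eqQZ (p (s c) c') (B c c').
Proof.
move=> BP.
have [s sP] := fin_all_exists (fun c => perfect_repr pP (fun x y => symbilDr c x y BP)).
exists s; split=> // x y; apply: (perfect_inj pP) => c.
by rewrite (perfectDl pP) !sP (symbilDl BP).
Qed.

Lemma metab_neg B : symbil B -> fb_iso (metab p B) (fb_neg (metab p B)).
Proof.
move=> BP; have [s [sD sP]] := symbil_repr BP.
(* The sign on [D] negates both [p] terms, and the two [s] terms contribute [-2B], turning [B] into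
   [-B]. *)
pose f (x : carrier (metab p B)) : carrier (metab p B) := (- x.1 - s x.2, x.2).
have fK : cancel f f by case=> d c; rewrite /f /= opprD !opprK addrK.
apply: (@fb_iso_can (metab p B) (fb_neg (metab p B)) f f fK fK)
  => [[d c] [d' c']|[d c] [d' c']]; rewrite /f /=.
  by congr pair; rewrite /= sD !opprD addrACA.
rewrite !(perfectDl pP) !(addQZN (fun x y => perfectDl pP x y _)) !sP.
by rewrite [B c' c](symbilC BP); apply: eqQZ_eq; ring.
Qed.

Lemma symbilD_symbil B B' : symbil B -> symbil B' ->
  symbil (fun c c' => B c c' + B' c c').
Proof.
move=> BP BP'; split=> [c c' x|c c'].
  by rewrite (symbilDl BP) (symbilDl BP'); apply: eqQZ_eq; ring.
by rewrite (symbilC BP) (symbilC BP').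
Qed.

Lemma symbilN_symbil B : symbil B -> symbil (fun c c' => - B c c').
Proof.
move=> BP; split=> [c c' x|c c']; last by rewrite (symbilC BP).
by rewrite (symbilDl BP); apply: eqQZ_eq; ring.
Qed.

(* The shear [c2 |-> c2 + c1] adds [B1] to the form on the first [C]; its cross
   terms are absorbed by [d1 |-> d1 - d2 - s c2], with [s] representing [B1]. *)
Lemma metab_shear B B1 : symbil B -> symbil B1 ->
  fb_iso (osum (metab p (fun c c' => B c c' + B1 c c')) (metab p B1))
         (osum (metab p B) (metab p B1)).
Proof.
move=> BP BP1; have [s [sD sP]] := symbil_repr BP1.
set F := osum _ _; set G := osum _ _.
pose f (x : carrier F) : carrier G :=
  ((x.1.1 - x.2.1 - s x.2.2, x.1.2), (x.2.1, x.2.2 + x.1.2)).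
pose g (x : carrier G) : carrier F :=
  ((x.1.1 + x.2.1 + s (x.2.2 - x.1.2), x.1.2), (x.2.1, x.2.2 - x.1.2)).
apply: (@fb_iso_can F G f g).
- by case=> [[d1 c1] [d2 c2]]; rewrite /f /g /= addrK [_ - s c2]addrAC subrK subrK.
- by case=> [[d1 c1] [d2 c2]]; rewrite /f /g /= subrK addrAC addrK addrK.
- case=> [[d1 c1] [d2 c2]] [[d1' c1'] [d2' c2']]; rewrite /f /=.
  have E (a a' b b' t t' : D) :
      a + a' - (b + b') - (t + t') = (a - b - t) + (a' - b' - t').
    by rewrite !opprD [RHS]addrACA; congr (_ + _); exact: addrACA.
  by congr (pair (pair _ _) (pair _ _)); [rewrite /= sD E|exact: addrACA].
case=> [[d1 c1] [d2 c2]] [[d1' c1'] [d2' c2']]; rewrite /f /=.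
rewrite !(perfectDl pP, perfectDr pP).
rewrite !(addQZN (fun x y => perfectDl pP x y _)) !sP.
rewrite !(symbilDl BP1, symbilDr _ _ _ BP1) [B1 c2' c1](symbilC BP1).
by apply: eqQZ_eq; ring.
Qed.
End Metab.

(** * Products and transport of metabolic forms *)

Lemma perfect_prod (D C D' C' : finZmodType) (p : D -> C -> rat)
    (p' : D' -> C' -> rat) :
  perfect p -> perfect p' ->
  perfect (fun (x : prodFZ D D') (y : prodFZ C C') => p x.1 y.1 + p' x.2 y.2).
Proof.
move=> pP pP'; split.
- by move=> [d d'] [e e'] [c c'] /=; rewrite (perfectDl pP) (perfectDl pP');
    apply: eqQZ_eq; ring.
- by move=> [d d'] [c c'] [e e'] /=; rewrite (perfectDr pP) (perfectDr pP');
    apply: eqQZ_eq; ring.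
- move=> [d d'] h; congr pair.
    apply: (perfect_nondegl pP) => c; have := h (c, 0) => /=.
    by rewrite (addQZ0 (perfectDr pP' d')) addr0.
  apply: (perfect_nondegl pP') => c; have := h (0, c) => /=.
  by rewrite (addQZ0 (perfectDr pP d)) add0r.
- move=> [c c'] h; congr pair.
    apply: (perfect_nondegr pP) => d; have := h (d, 0) => /=.
    by rewrite (addQZ0 (fun x y => perfectDl pP' x y c')) addr0.
  apply: (perfect_nondegr pP') => d; have := h (0, d) => /=.
  by rewrite (addQZ0 (fun x y => perfectDl pP x y c)) add0r.
Qed.

Lemma symbil_prod (C C' : finZmodType) (B : C -> C -> rat) (B' : C' -> C' -> rat) :
  symbil B -> symbil B' ->
  symbil (fun x y : prodFZ C C' => B x.1 y.1 + B' x.2 y.2).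
Proof.
move=> BP BP'; split=> [[c c'] [e e'] [x x']|[c c'] [e e']] /=.
  by rewrite (symbilDl BP) (symbilDl BP'); apply: eqQZ_eq; ring.
by rewrite (symbilC BP) (symbilC BP').
Qed.

Lemma metab_prod (D C D' C' : finZmodType) (p : D -> C -> rat)
    (p' : D' -> C' -> rat) B B' :
  fb_iso (osum (metab p B) (metab p' B'))
    (metab (fun (x : prodFZ D D') (y : prodFZ C C') => p x.1 y.1 + p' x.2 y.2)
           (fun x y : prodFZ C C' => B x.1 y.1 + B' x.2 y.2)).
Proof.
set F := osum _ _; set G := metab _ _.
apply: (@fb_iso_can F G (fun x => ((x.1.1, x.2.1), (x.1.2, x.2.2)))
                        (fun x => ((x.1.1, x.2.1), (x.1.2, x.2.2)))).
- by case=> [[? ?] [? ?]].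
- by case=> [[? ?] [? ?]].
- by case=> [[? ?] [? ?]] [[? ?] [? ?]].
- by case=> [[? ?] [? ?]] [[? ?] [? ?]]; apply: eqQZ_eq => /=; ring.
Qed.

Lemma osum_opp_metab F : is_fbform F ->
  fb_iso (osum F (fb_neg F)) (metab (bf F) (bf F)).
Proof.
move=> FP; have FP' := fbform_perfect FP; symmetry.
set G := osum _ _; set M := metab _ _.
(* The first factor of [M] goes to the diagonal and the second to [F + 0], where the form is
   [bf F]. *)
apply: (@fb_iso_can M G (fun x => (x.1 + x.2, x.1)) (fun x => (x.2, x.1 - x.2))).
- by case=> x y; rewrite /= addrC addKr.
- by case=> x y; rewrite /= addrC subrK.
- by case=> [x y] [x' y'] /=; congr pair; rewrite /= addrACA.
case=> [x y] [x' y'] /=; rewrite !(perfectDl FP', perfectDr FP').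
by rewrite [bf F x' y](symbilC (fbform_symbil FP)); apply: eqQZ_eq; ring.
Qed.

(** The adjoint [k] sends [d] to the element representing the functional [p d (h c)] of [c]. *)
Lemma perfect_adj (D C D' C' : finZmodType) (p : D -> C -> rat)
    (p' : D' -> C' -> rat) (h : C' -> C) : perfect p -> perfect p' -> {morph h : x y / x + y} ->
  exists k : D -> D', {morph k : x y / x + y} /\
    forall d c, eqQZ (p' (k d) c) (p d (h c)).
Proof.
move=> pP pP' hD.
have pD d : addQZ (fun c => p d (h c)).
  by move=> x y; rewrite hD (perfectDr pP).
have [k kP] := fin_all_exists (fun d => perfect_repr pP' (pD d)).
exists k; split=> // x y; apply: (perfect_inj pP') => c.
by rewrite (perfectDl pP') !kP (perfectDl pP).
Qed.

(** As [D] and [D'] are dual to [C] and [C'], the isomorphism [h] is completed on them by the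
    adjoint of its inverse, which carries [p] to [p']. *)
Lemma metab_transport (D C D' C' : finZmodType) (p : D -> C -> rat)
    (p' : D' -> C' -> rat) (h : C -> C') B :
  perfect p -> perfect p' -> {morph h : x y / x + y} -> bijective h ->
  fb_iso (metab p (fun x y => B (h x) (h y))) (metab p' B).
Proof.
move=> pP pP' hD [g hg gh].
have gD : {morph g : x y / x + y} by move=> x y; apply: (can_inj hg); rewrite hD !gh.
have [k [kD kP]] := perfect_adj pP pP' gD.
have [l [lD lP]] := perfect_adj pP' pP hD.
set F := metab _ _; set G := metab _ _.
apply: (@fb_iso_can F G (fun x => (k x.1, h x.2)) (fun x => (l x.1, g x.2))).
- case=> d c; rewrite /= hg; congr pair; apply: (perfect_inj pP) => y.
  by rewrite lP kP hg.
- case=> d c; rewrite /= gh; congr pair; apply: (perfect_inj pP') => y.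
  by rewrite kP lP gh.
- by case=> d c [d' c']; rewrite /= kD hD.
- by case=> d c [d' c']; rewrite /= !kP !hg.
Qed.

(** * Split forms are metabolic *)

(** Take [D = S] and [C] its complement [T]. An element of [S] orthogonal to [T] is orthogonal to
    everything; an element of [T] orthogonal to [S] lies in [S], hence is 0. *)
Lemma split_metab F : is_split F ->
  exists (D C : finZmodType) (p : D -> C -> rat) (B : C -> C -> rat),
    [/\ perfect p, symbil B & fb_iso F (metab p B)].
Proof.
case=> FP [S [[HS [T [HT ST0 STD]]] Sperp]].
have FP' := fbform_perfect FP; have Fsym := symbilC (fbform_symbil FP).
have SS x y : x \in S -> y \in S -> eqQZ (bf F x y) 0 by move=> /Sperp; apply.
pose D : finZmodType := subgroup_of HS; pose C : finZmodType := subgroup_of HT.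
pose i : D -> carrier F := @sg_val _ _ HS; pose j : C -> carrier F := @sg_val _ _ HT.
have iS d : i d \in S by exact: sg_valP.
have jT c : j c \in T by exact: sg_valP.
have pP : perfect (fun d c => bf F (i d) (j c)).
  split=> [d d' c|d c c'|d h|c h].
  - exact: (perfectDl FP').
  - exact: (perfectDr FP').
  - apply/val_inj/(perfect_nondegl FP') => y.
    have [x [z [xS zT ->]]] := STD y.
    rewrite (perfectDr FP') SS // add0r.
    exact: (h (SubgroupOf HT zT)).
  - apply/val_inj/ST0; last exact: jT.
    by apply/Sperp => y yS; rewrite Fsym; exact: (h (SubgroupOf HS yS)).
exists D, C, (fun d c => bf F (i d) (j c)), (fun c c' => bf F (j c) (j c')).
split=> //.
  by split=> [c c' x|c c']; [exact: (perfectDl FP')|exact: Fsym].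
symmetry; set M := metab _ _.
pose f (x : carrier M) : carrier F := i x.1 + j x.2.
have [z|g gK] := fin_all_exists (T := carrier F) (P := fun z w => f w = z).
  by have [x [y [xS yT ->]]] := STD z; exists (SubgroupOf HS xS, SubgroupOf HT yT).
have f_inj : injective f.
  case=> d c [d' c']; rewrite /f /= => /eqP; rewrite -subr_eq0 opprD addrACA.
  rewrite addr_eq0 => /eqP e.
  have d0 : i d - i d' = 0.
    by apply: ST0; [rewrite HS.2|rewrite e -sub0r !HT.2 // HT.1].
  congr pair; apply: val_inj; apply/eqP; rewrite -subr_eq0; apply/eqP => //.
  by rewrite -[LHS]opprK -e d0 oppr0.
apply: (@fb_iso_can M F f g _ gK).
- by move=> x; apply: f_inj; rewrite gK.
- by case=> d c [d' c']; rewrite /f /= addrACA.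
- case=> d c [d' c']; rewrite /f /= !(perfectDl FP', perfectDr FP').
  rewrite (SS _ _ (iS d) (iS d')) [bf F (j c) (i d')]Fsym.
  by apply: eqQZ_eq; ring.
Qed.

Lemma zero_form_split : is_split zero_form.
Proof.
have all0 (x : carrier zero_form) : x = 0 by rewrite [x]ord1; apply: val_inj.
split; first by split=> [*|*|*|*]; rewrite ?addr0.
exists [set 0]; split; first split.
- by split=> [|x y _ _]; rewrite inE ?[x - y]all0.
- exists [set 0]; split=> //.
  + by split=> [|x y _ _]; rewrite inE ?[x - y]all0.
  + by move=> z; exists 0, 0; rewrite !inE [z]all0 addr0.
- by move=> x; rewrite [x]all0 inE eqxx.
Qed.

Lemma fbform_osum F G : is_fbform F -> is_fbform G -> is_fbform (osum F G).
Proof.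
move=> FP GP.
have [Dl Dr _ _] := perfect_prod (fbform_perfect FP) (fbform_perfect GP).
have [_ sym] := symbil_prod (fbform_symbil FP) (fbform_symbil GP).
have [_ _ nd _] := perfect_prod (fbform_perfect FP) (fbform_perfect GP).
by split.
Qed.

(** * Torsion counts of carriers, and the two directions of the theorem *)

Lemma ntorsion_bij (A B : finZmodType) (f : A -> B) n :
  {morph f : x y / x + y} -> bijective f -> ntorsion A n = ntorsion B n.
Proof.
move=> fD fB; have f0 : f 0 = 0 by apply: (addrI (f 0)); rewrite -fD !addr0.
have fMn x : f (x *+ n) = f x *+ n.
  by elim: n => [|k IHk]; rewrite ?mulr0n // !mulrS fD IHk.
rewrite /ntorsion -(on_card_preimset (f := f)); last exact: onW_bij.
by apply: eq_card => x; rewrite !inE -fMn -[in RHS]f0 (inj_eq (bij_inj fB)).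
Qed.

Lemma ntorsion_prod (A B : finZmodType) n :
  ntorsion (prodFZ A B) n = (ntorsion A n * ntorsion B n)%N.
Proof.
rewrite /ntorsion -cardsX; apply: eq_card => -[x y]; rewrite !inE /=.
rewrite -[RHS]/((x *+ n, y *+ n) == 0); congr (_ == _).
by elim: n => [|k IHk]; rewrite ?mulr0n // !mulrS IHk.
Qed.

Lemma metab_ext (D C : finZmodType) (p : D -> C -> rat) (B B' : C -> C -> rat) :
  (forall c c', eqQZ (B c c') (B' c c')) -> fb_iso (metab p B) (metab p B').
Proof.
move=> e; apply: (@fb_iso_can (metab p B) (metab p B') id id) => // x y.
by rewrite /= e.
Qed.

Lemma fb_iso_ntorsion F G n : fb_iso F G ->
  ntorsion (carrier F) n = ntorsion (carrier G) n.
Proof. by case=> f [fD fB _]; exact: ntorsion_bij fD fB. Qed.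

Lemma Tform_double F : is_Tform F -> witt_eq (osum F F) zero_form.
Proof.
case=> FP FN; exists zero_form, (metab (bf F) (bf F)); split.
- exact: zero_form_split.
- by apply: metab_split; [exact: fbform_perfect|exact: fbform_symbil].
rewrite osum0 (osumC zero_form) osum0 -osum_opp_metab //.
by rewrite {2}FN; reflexivity.
Qed.

Lemma double_Tform F : is_fbform F -> witt_eq (osum F F) zero_form ->
  exists T, is_Tform T /\ witt_eq T F.
Proof.
move=> FP [S [S' [Sspl S'spl FFS]]].
have [D [C [p [B [pP BP SM]]]]] := split_metab Sspl.
have [D' [C' [p' [B' [pP' BP' SM']]]]] := split_metab S'spl.
have {}FFS : fb_iso (osum (osum F F) (metab p B)) (metab p' B').
  by rewrite -SM -SM' FFS osumC osum0; reflexivity.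
pose A := carrier F; have FP' := fbform_perfect FP; have Fsym := fbform_symbil FP.
(* These present [R = F + -F + S] as [metab q Q]. *)
pose q (x : prodFZ A D) (y : prodFZ A C) := bf F x.1 y.1 + p x.2 y.2.
pose Q (x y : prodFZ A C) := bf F x.1 y.1 + B x.2 y.2.
have qP : perfect q := perfect_prod FP' pP.
have QP : symbil Q := symbil_prod Fsym BP.
have [h [hD hB]] : exists h : prodFZ A C -> C',
    {morph h : x y / x + y} /\ bijective h.
  (* Comparing carriers in [FFS] gives [(#A[n] * #C[n])^2 = #C'[n]^2]; square roots are then
     taken. *)
  apply: ntorsion_iso => n; have := fb_iso_ntorsion n FFS.
  rewrite /= !ntorsion_prod (perfect_ntorsion n pP) (perfect_ntorsion n pP').
  by rewrite mulnACA !mulnn => /eqP; rewrite eqn_sqr => /eqP.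
(* Pulling [B'] back along [h] puts [S'] and [R] over the same pairing [q]. *)
pose Q' x y := B' (h x) (h y).
have QP' : symbil Q'.
  by split=> [c c' x|c c']; rewrite /Q' ?hD; [rewrite (symbilDl BP')|rewrite (symbilC BP')].
have XP := symbilD_symbil QP (symbilN_symbil QP').
(* Since [Q = Q' + X], adding [metab q X] allows the shear to exchange [Q] and [Q']. *)
set X := (fun c c' => Q c c' - Q' c c') in XP.
have M'Q : fb_iso (metab p' B') (metab q Q').
  by symmetry; exact: metab_transport.
have MQ : fb_iso (osum (osum F (fb_neg F)) (metab p B)) (metab q Q).
  by rewrite osum_opp_metab //; exact: metab_prod.
(* Regroup [F + (F + -F + S)] as [-F + (F + F + S)], whose second part is [S']. *)
have swap : fb_iso (osum F (metab q Q)) (osum (fb_neg F) (metab q Q')).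
  rewrite -MQ -M'Q -FFS osumA (osumA F) (osumC (osum F F)) -osumA.
  by reflexivity.
have shear : fb_iso (osum (metab q Q) (metab q X)) (osum (metab q Q') (metab q X)).
  rewrite -(metab_shear qP QP' XP); apply: osum_iso; last by reflexivity.
  by apply: metab_ext => c c'; apply: eqQZ_eq; rewrite /X; ring.
exists (osum F (osum (metab q Q) (metab q X))); split; [split|].
- by do 2?apply: fbform_osum => //; exact: metab_fbform.
(* Negation only affects [F], the metabolic parts being isomorphic to their negatives; [swap] then
   replaces [F] by [-F] and [Q] by [Q'], and [shear] restores [Q]. *)
- rewrite osum_neg osum_neg -!metab_neg // osumA swap -osumA shear.
  by reflexivity.
(* The split summand added to [F] is found by unification, as the metabolic form on the products. *)
exists zero_form; eexists; split; first exact: zero_form_split; last first.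
  by rewrite osum0 metab_prod; reflexivity.
by apply: metab_split; [exact: perfect_prod|exact: symbil_prod].
Qed.

(* In W: the class of F is [F], [F] + [G] = [osum F G], 0 = [zero_form],
   and [F] = [G] iff witt_eq F G.  So 2[F] = 0 iff witt_eq (osum F F) zero_form. *)
Theorem theorem3 :
  (forall F : fbdata, is_Tform F -> witt_eq (osum F F) zero_form) /\
  (forall F : fbdata, is_fbform F -> witt_eq (osum F F) zero_form ->
     exists T : fbdata, is_Tform T /\ witt_eq T F).
Proof. by split; [exact: Tform_double|exact: double_Tform]. Qed.
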